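(* Let $\mathbb{F}_q$ be a finite field of cardinality $q$ and characteristic $p\ge 3$. Let $\mathscr{G}_2(\mathbb{F}_q)$ be the graph with vertex set $\mathrm{SL}_2(\mathbb{F}_q)$ in which two matrices $x,y$ form an edge if and only if $\det(x+y)=0$. Then $$q+1\ \le\ \chi\big(\mathscr{G}_2(\mathbb{F}_q)\big)\ \le\ 8(q+1).$$
   Context: $\chi$ denotes the chromatic number of a graph. *)

(* Defs.v *)
From HB Require Import structures.
From mathcomp Require Import all_boot all_order all_algebra.

Set Implicit Arguments.
Unset Strict Implicit.
Unset Printing Implicit Defensive.

Import GRing.Theory.

Record sgraph := SGraph {
  vertex :> finType;
  edge : rel vertex;
  edge_sym : symmetric edge;
  edge_irrefl : irreflexive edge }.

Definition proper_coloring (G : sgraph) (k : nat) (c : {ffun G -> 'I_k}) : bool :=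
  [forall x, forall y, edge x y ==> (c x != c y)].

Definition colorable (G : sgraph) (k : nat) : bool :=
  [exists c : {ffun G -> 'I_k}, proper_coloring c].

Lemma colorable_exists (G : sgraph) : exists k, colorable G k.
Proof.
exists #|G|; apply/existsP; exists [ffun x => enum_rank x].
apply/'forall_forallP => x y; apply/implyP => exy; rewrite !ffunE.
by apply: contraTneq exy => /enum_rank_inj ->; rewrite edge_irrefl.
Qed.

Definition chromatic_number (G : sgraph) : nat := ex_minn (colorable_exists G).

Local Open Scope ring_scope.

Definition SL2 (F : finFieldType) : finType := {x : 'M[F]_2 | \det x == 1}.

(* The condition [x != y] only makes the relation irreflexive over every F:
   as \det (x + x) = 4 on SL2, it is redundant in odd characteristic
   (lemma [G2_edgeE]). *)
Definition G2_edge (F : finFieldType) : rel (SL2 F) :=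
  fun x y => (x != y) && (\det (val x + val y) == 0).

Lemma G2_edge_sym (F : finFieldType) : symmetric (@G2_edge F).
Proof. by move=> x y; rewrite /G2_edge eq_sym addrC. Qed.

Lemma G2_edge_irrefl (F : finFieldType) : irreflexive (@G2_edge F).
Proof. by move=> x; rewrite /G2_edge eqxx. Qed.

Definition G2 (F : finFieldType) : sgraph :=
  SGraph (@G2_edge_sym F) (@G2_edge_irrefl F).

Lemma G2_edgeE (F : finFieldType) (p : nat) (x y : G2 F) :
  p \in [pchar F] -> (2 < p)%N ->
  edge x y = (\det (val x + val y) == 0).
Proof.
move=> charFp p_gt2; rewrite /edge /= /G2_edge; case: eqVneq => //= <-.
have nz2 : (2%:R : F) != 0.
  rewrite -(dvdn_pcharf charFp); apply/negP => /(@dvdn_leq p 2 isT).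
  by rewrite leqNgt p_gt2.
rewrite -mulr2n -scaler_nat detZ (eqP (valP x)) mulr1.
by rewrite expf_eq0 (negPf nz2) andbF.
Qed.

(* Main.v *)
(** For x, y in SL_2 an edge means that x - (-y) is singular. Let agree(x, y) be
    the number of nonzero vectors on which x and y agree, A an independent set,
    and f = 1_A + 1_{-A}, g = 1_A - 1_{-A}. Independence gives
    <f, agree f> = <g, agree g>. Summing Cauchy-Schwarz over the fibres of
    x |-> x v shows <f, agree f> >= (sum f)^2 = 4|A|^2. On the other hand
    agree^2 - 2q(q-1) agree is invariant under y |-> -y, so it kills the odd
    function g, whence <g, agree g> <= 2q(q-1) |g|^2 <= 4q(q-1)|A|. Thus
    |A| <= q(q-1), while |SL_2| = (q^2-1)q.
    For the upper bound, an edge between matrices whose first columns are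
    proportional forces these columns to be opposite, so 2(q+1) colours suffice. *)
Require Import Defs.
From mathcomp Require Import all_boot all_order all_algebra.
From mathcomp Require Import ring zify.

Set Implicit Arguments.
Unset Strict Implicit.
Unset Printing Implicit Defensive.

Import Order.TTheory GRing.Theory Num.Theory.
Local Open Scope ring_scope.

(** * Inequalities for finite sums of integers *)

Lemma natr_card (R : nzRingType) (T : finType) (P : pred T) :
  #|[set x | P x]|%:R = \sum_x (P x)%:R :> R.
Proof.
rewrite -sum1_card natr_sum [in RHS](bigID P) /= [X in _ + X]big1 ?addr0.
  by apply: eq_big => [x|x]; rewrite inE // => ->.
by move=> x /negbTE ->.
Qed.

Lemma cauchy_schwarz_const (T : finType) (P : pred T) (a : T -> int) :
  (\sum_(x | P x) a x) ^+ 2 <= #|P|%:R * \sum_(x | P x) a x ^+ 2.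
Proof.
set S := \sum_(x | P x) a x; set Q := \sum_(x | P x) _; set N : int := #|P|%:R.
have [P0|P_gt0] := posnP #|P|.
  rewrite /S big_pred0 ?expr0n ?/N ?P0 ?mul0r // => x.
  by move/card0_eq: P0 => /(_ x).
have N_gt0 : 0 < N by rewrite ltr0n.
(* [N * a x - S] is [N] times the deviation from the mean, scaled so that everything stays in
   [int]. *)
have: 0 <= \sum_(x | P x) (N * a x - S) ^+ 2 by apply: sumr_ge0 => x _; apply: sqr_ge0.
suff ->: \sum_(x | P x) (N * a x - S) ^+ 2 = N * (N * Q - S ^+ 2).
  by rewrite pmulr_rge0 // subr_ge0.
rewrite (eq_bigr (fun x => N ^+ 2 * a x ^+ 2 - 2 * N * S * a x + S ^+ 2)); last first.
  by move=> x _; ring.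
rewrite big_split /= sumrB -!mulr_sumr -/S -/Q sumr_const -mulr_natr -/N.
ring.
Qed.

(* [k^2 g = l k g] and [0 <= |k g - l g|^2 = l (l |g|^2 - <g, k g>)]. *)
Lemma quadratic_form_le (T : finType) (k : T -> T -> int) (g : T -> int) (l : int) :
  0 < l -> (forall x y, k x y = k y x) ->
  (forall x, \sum_y (\sum_z k x z * k z y) * g y = l * \sum_y k x y * g y) ->
  \sum_x \sum_y g x * g y * k x y <= l * \sum_x g x ^+ 2.
Proof.
move=> l_gt0 k_sym k2g; pose h x := \sum_y k x y * g y.
have gh : \sum_x \sum_y g x * g y * k x y = \sum_x g x * h x.
  by apply: eq_bigr => x _; rewrite mulr_sumr; apply: eq_bigr => y _; ring.
have kh x : \sum_z k x z * h z = l * h x.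
  rewrite -k2g; under eq_bigr do rewrite mulr_sumr.
  rewrite exchange_big; apply: eq_bigr => y _ /=.
  by rewrite mulr_suml; apply: eq_bigr => z _; rewrite mulrA.
have hh : \sum_x h x ^+ 2 = l * \sum_x g x * h x.
  rewrite mulr_sumr.
  transitivity (\sum_x \sum_y h x * k x y * g y).
    by apply: eq_bigr => x _; rewrite expr2 {2}/h mulr_sumr; apply: eq_bigr => y _; ring.
  rewrite exchange_big; apply: eq_bigr => y _ /=.
  rewrite mulrCA -kh mulr_sumr; apply: eq_bigr => x _.
  by rewrite (k_sym y x); ring.
rewrite gh.
have: 0 <= \sum_x (h x - l * g x) ^+ 2 by apply: sumr_ge0 => x _; apply: sqr_ge0.
rewrite (eq_bigr (fun x => h x ^+ 2 - 2 * l * (g x * h x) + l ^+ 2 * g x ^+ 2)); last first.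
  by move=> x _; ring.
rewrite big_split /= sumrB -!mulr_sumr hh.
set X := \sum_x _; set Y := \sum_x _.
have ->: l * X - 2 * l * X + l ^+ 2 * Y = l * (l * Y - X) by ring.
by rewrite pmulr_rge0 // subr_ge0.
Qed.


(** * Two-by-two matrices and the area form on the plane *)

Lemma forall_ord2 (P : 'I_2 -> Prop) : P 0 -> P 1 -> forall i, P i.
Proof.
move=> P0 P1 [[|[|//]] Hi]; first by have -> : Ordinal Hi = 0 by exact: val_inj.
by have -> : Ordinal Hi = 1 by exact: val_inj.
Qed.

Lemma det_mx22 (R : comNzRingType) (x : 'M[R]_2) :
  \det x = x 0 0 * x 1 1 - x 0 1 * x 1 0.
Proof.
have l01 : lift 0 0 = 1 :> 'I_2 by exact: val_inj.
have l10 : lift 1 0 = 0 :> 'I_2 by exact: val_inj.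
rewrite (expand_det_row _ 0) big_ord_recl big_ord1 l01 /cofactor !det_mx11 !mxE.
by rewrite l01 l10 /=; ring.
Qed.

Lemma mulmx_cV2 (R : comNzRingType) (x : 'M[R]_2) (v : 'cV[R]_2) i :
  (x *m v) i 0 = x i 0 * v 0 0 + x i 1 * v 1 0.
Proof.
by rewrite mxE big_ord_recl big_ord1 (_ : lift 0 0 = 1 :> 'I_2) //; exact: val_inj.
Qed.

Lemma eq_cV2 (R : nzRingType) (v w : 'cV[R]_2) :
  v 0 0 = w 0 0 -> v 1 0 = w 1 0 -> v = w.
Proof.
by move=> e0 e1; apply/matrixP => i j; rewrite (ord1 j); move: i; apply: forall_ord2.
Qed.

(** The standard symplectic form on the plane, preserved by SL_2; it detects collinearity. *)
Definition cross (R : comNzRingType) (v w : 'cV[R]_2) : R :=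
  v 0 0 * w 1 0 - v 1 0 * w 0 0.

Lemma crossC (R : comNzRingType) (v w : 'cV[R]_2) : cross w v = - cross v w.
Proof. by rewrite /cross; ring. Qed.

Lemma crossDr (R : comNzRingType) (v w w' : 'cV[R]_2) :
  cross v (w + w') = cross v w + cross v w'.
Proof. by rewrite /cross !mxE; ring. Qed.

Lemma crossBr (R : comNzRingType) (v w w' : 'cV[R]_2) :
  cross v (w - w') = cross v w - cross v w'.
Proof. by rewrite /cross !mxE; ring. Qed.

Lemma crossZr (R : comNzRingType) (c : R) (v w : 'cV[R]_2) :
  cross v (c *: w) = c * cross v w.
Proof. by rewrite /cross !mxE; ring. Qed.

Lemma crossNr (R : comNzRingType) (v w : 'cV[R]_2) : cross v (- w) = - cross v w.
Proof. by rewrite /cross !mxE; ring. Qed.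

Lemma crossvv (R : comNzRingType) (v : 'cV[R]_2) : cross v v = 0.
Proof. by rewrite /cross; ring. Qed.

Lemma crossv0 (R : comNzRingType) (v : 'cV[R]_2) : cross v 0 = 0.
Proof. by rewrite /cross !mxE; ring. Qed.

Lemma cross_mulmx (R : comNzRingType) (x : 'M[R]_2) (v w : 'cV[R]_2) :
  cross (x *m v) (x *m w) = \det x * cross v w.
Proof. by rewrite /cross !mulmx_cV2 det_mx22; ring. Qed.

Lemma det_row_mx_cross (R : comNzRingType) (v w : 'cV[R]_2) :
  \det (row_mx v w) = cross v w.
Proof.
have E0 i : row_mx v w i 0 = v i 0.
  by rewrite -(row_mxEl v w); congr (row_mx v w i _); exact: val_inj.
have E1 i : row_mx v w i 1 = w i 0.
  by rewrite -(row_mxEr v w); congr (row_mx v w i _); exact: val_inj.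
by rewrite det_mx22 !E0 !E1 [w 0 0 * _]mulrC.
Qed.

(** Cramer's rule without division: the coordinates of [c] in the basis [a], [b], scaled by
    [cross a b]. *)
Lemma cramer2 (R : comNzRingType) (a b c : 'cV[R]_2) :
  cross a b *: c = cross c b *: a + cross a c *: b.
Proof. by apply: eq_cV2; rewrite /cross !mxE; ring. Qed.

(** * Counting vectors and elements of SL_2 over a finite field *)

Section Field.
Variable F : finFieldType.
Implicit Types (v w a b : 'cV[F]_2) (x y z : SL2 F).

Lemma cross1_ex a : a != 0 -> exists b, cross a b = 1.
Proof.
move=> a_neq0; suff [b] : exists b, cross a b != 0.
  by move=> ab; exists ((cross a b)^-1 *: b); rewrite crossZr mulVf.
have [a0|a0] := eqVneq (a 0 0) 0; last first.
  by exists (delta_mx 1 0); rewrite /cross !mxE /= mulr1 mulr0 subr0.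
exists (delta_mx 0 0); rewrite /cross !mxE /= mulr1 mulr0 sub0r oppr_eq0.
by apply: contraNneq a_neq0 => a1; apply/eqP/eq_cV2; rewrite mxE.
Qed.

Lemma cross_eq0 a b : a != 0 -> cross a b = 0 -> exists t, b = t *: a.
Proof.
move=> /cross1_ex[c ac1] ab0; exists (cross b c).
by rewrite -[LHS]scale1r -ac1 (cramer2 a c b) ab0 scale0r addr0.
Qed.

(** The solutions form an affine line with direction [a]. *)
Lemma card_cross_eq a (c : F) : a != 0 -> #|[set b | cross a b == c]| = #|F|.
Proof.
move=> a_neq0; have [b ab1] := cross1_ex a_neq0.
pose f t := c *: b + t *: a.
have f_inj : injective f.
  move=> s t /addrI/eqP; rewrite -subr_eq0 -scalerBl scaler_eq0 (negPf a_neq0) orbF.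
  by rewrite subr_eq0 => /eqP.
rewrite -(card_imset _ f_inj); apply: eq_card => d; rewrite inE.
apply/eqP/imsetP => [ad|[t _ ->]].
  have [t /eqP dE] : exists t, d - c *: b = t *: a.
    by apply: cross_eq0; rewrite // crossBr crossZr ab1 mulr1 ad subrr.
  by exists t; rewrite // /f addrC; apply/eqP; rewrite -subr_eq.
by rewrite /f crossDr !crossZr ab1 crossvv mulr1 mulr0 addr0.
Qed.

Lemma SL2_unit x : val x \in unitmx.
Proof. by rewrite unitmxE (eqP (valP x)) unitr1. Qed.

Lemma SL2_mulmx_inj x : injective (mulmx (val x) : 'cV_2 -> 'cV_2).
Proof. exact: (can_inj (mulKmx (SL2_unit x))). Qed.

Lemma cross_SL2 x v w : cross (val x *m v) (val x *m w) = cross v w.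
Proof. by rewrite cross_mulmx (eqP (valP x)) mul1r. Qed.

(** Images of the basis [v], [w] determine a unique matrix, whose determinant is the ratio of
    [cross a b] to [cross v w]. *)
Lemma card_SL2_frame v w a b : cross v w != 0 ->
  #|[set z : SL2 F | (val z *m v == a) && (val z *m w == b)]|
  = (cross a b == cross v w) :> nat.
Proof.
move=> vw; pose M : 'M[F]_2 := row_mx v w; pose N : 'M[F]_2 := row_mx a b.
have M_unit : M \in unitmx by rewrite unitmxE det_row_mx_cross unitfE.
have zE z : (val z *m v == a) && (val z *m w == b) = (val z == N *m invmx M).
  rewrite -(can2_eq (mulmxK M_unit) (mulmxKV M_unit)).
  rewrite /M (mul_mx_row (val z) v w); apply/andP/eqP => [[/eqP-> /eqP->] //|].
  by move=> e; have [-> ->] := @eq_row_mx _ 2 1 1 _ _ a b e.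
have detE : (\det (N *m invmx M) == 1) = (cross a b == cross v w).
  by rewrite det_mulmx det_inv !det_row_mx_cross -(inj_eq (mulIf vw)) divfK // mul1r.
rewrite -detE; have [det1|det_neq1] := boolP (\det _ == 1).
  rewrite (_ : [set z | _] = [set (Sub (N *m invmx M) det1 : SL2 F)]) ?cards1 //.
  by apply/setP => z; rewrite !inE zE -val_eqE.
apply/eqP; rewrite cards_eq0; apply/eqP/setP => z; rewrite !inE zE.
by apply: contraNF det_neq1 => /eqP <-; exact: (valP z).
Qed.

(** Complete [v] by [w] with [cross v w = 1]: then [z] corresponds to the image [b] of [w], which
    ranges over the affine line [cross a b = 1]. *)
Lemma card_SL2_transport v a : v != 0 -> a != 0 ->
  #|[set z : SL2 F | val z *m v == a]| = #|F|.
Proof.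
move=> v_neq0 a_neq0; have [w vw1] := cross1_ex v_neq0.
rewrite -(card_cross_eq 1 a_neq0) -2!sum1_card.
rewrite (partition_big (fun z : SL2 F => val z *m w) predT) //=.
rewrite [RHS]big_mkcond; apply: eq_bigr => b _.
transitivity (nat_of_bool (cross a b == cross v w)); last first.
  by rewrite inE vw1; case: (_ == _).
rewrite -card_SL2_frame ?vw1 ?oner_eq0 // -sum1_card.
by apply: eq_bigl => z; rewrite !inE.
Qed.

Lemma card_cV2_neq0 : #|[pred v : 'cV[F]_2 | v != 0]| = (#|F| ^ 2).-1%N.
Proof.
by have := cardC1 (0 : 'cV[F]_2); rewrite card_mx muln1.
Qed.

Lemma card_SL2 : #|SL2 F| = ((#|F| ^ 2).-1 * #|F|)%N.
Proof.
pose e : 'cV[F]_2 := delta_mx 0 0.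
have e_neq0 : e != 0.
  by apply/eqP => /matrixP/(_ 0 0)/eqP; rewrite !mxE /= oner_eq0.
rewrite -cardsT -sum1_card.
rewrite (partition_big (fun z : SL2 F => val z *m e) [pred v : 'cV[F]_2 | v != 0]) /=; last first.
  by move=> z _; rewrite -(mulmx0 _ (val z)) (inj_eq (@SL2_mulmx_inj z)).
rewrite -card_cV2_neq0 -sum_nat_const; apply: eq_bigr => a a_neq0.
rewrite -(card_SL2_transport e_neq0 a_neq0) -sum1_card.
by apply: eq_bigl => z; rewrite !inE.
Qed.

(** * The agreement kernel and its square *)

Local Notation q := (#|F|%:R : int).

Lemma sum_cross_eq a (c : F) : a != 0 -> \sum_b (cross a b == c)%:R = q.
Proof. by move=> a_neq0; rewrite -(natr_card int) card_cross_eq. Qed.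

Lemma card_cV2 : #|'cV[F]_2|%:R = q ^+ 2.
Proof. by rewrite card_mx muln1 natrX. Qed.

Lemma sum_collinear w : w != 0 -> \sum_(v | (v != 0) && (cross v w == 0)) 1 = q - 1.
Proof.
move=> w_neq0; rewrite -(sum_cross_eq 0 w_neq0) [in RHS](bigD1 0) //= crossv0 eqxx.
rewrite addrC addrK [in RHS]big_mkcond [in LHS]big_mkcond /=.
by apply: eq_bigr => v _; rewrite crossC oppr_eq0; do 2 case: eqP.
Qed.

(** The sum counts the [v] off the line of [w] that are orthogonal to [a - w] for [cross]. If
    [a = w], all q^2 - q vectors off the line count. Otherwise [v] must lie on the line of [a - w]:
    this is the line of [w] itself when [a] and [w] are collinear, and else meets it only in 0,
    leaving q - 1 vectors. *)
Lemma sum_cross_congr w a : w != 0 ->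
  \sum_(v | cross v w != 0) (cross v a == cross v w)%:R
  = q * (q - 1) * (a == w)%:R + (q - 1) * (cross a w != 0)%:R.
Proof.
move=> w_neq0; pose P v := cross (a - w) v == 0.
have PE v : (cross v a == cross v w) = P v.
  by rewrite /P (crossC v) oppr_eq0 crossBr subr_eq0.
rewrite (eq_bigr (fun v => (P v)%:R)); last by move=> v _; rewrite PE.
have -> : (\sum_(v | cross v w != 0) (P v)%:R)%R
    = (\sum_v (P v)%:R - \sum_v ((cross w v == 0) && P v)%:R)%R :> int.
  rewrite [in RHS](bigID (fun v => cross v w == 0)) /= addrAC.
  rewrite -[LHS]add0r; congr (_ + _); apply/esym/eqP; rewrite subr_eq0 big_mkcond.
  by apply/eqP/eq_bigr => v _; rewrite (crossC v) oppr_eq0; case: eqP.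
have [a_eqw|a_neqw] := eqVneq a w.
  rewrite (eq_bigr (fun=> 1)) => [|v _]; last by rewrite /P a_eqw subrr (crossC v) crossv0 oppr0 eqxx.
  rewrite sumr_const card_cV2 (eq_bigr (fun v => (cross w v == 0)%:R)) => [|v _]; last first.
    by rewrite /P a_eqw subrr [cross 0 v]crossC crossv0 oppr0 eqxx andbT.
  by rewrite sum_cross_eq // a_eqw crossvv eqxx /=; ring.
have d_neq0 : a - w != 0 by rewrite subr_eq0.
rewrite sum_cross_eq //; have [aw0|aw] := eqVneq (cross a w) 0.
  rewrite (eq_bigr (fun v => (cross w v == 0)%:R)) => [|v _].
    by rewrite sum_cross_eq //=; ring.
  have [t dE] : exists t, a - w = t *: w.
    by apply: cross_eq0; rewrite // crossBr crossvv (crossC a) aw0 oppr0 addr0.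
  rewrite /P dE; case: eqP => //= wv0.
  by rewrite (crossC v) crossZr (crossC w) wv0 oppr0 mulr0 oppr0 eqxx.
rewrite (bigD1 0) //= big1 => [|v v_neq0].
  by rewrite /P !crossv0 eqxx /=; ring.
rewrite /P; case: (cross w v =P 0) => //= wv0.
case: (cross (a - w) v =P 0) => //= dv0; case/negP: v_neq0.
have dw : cross (a - w) w != 0.
  by rewrite (crossC w) oppr_eq0 crossBr crossvv subr0 (crossC a) oppr_eq0.
have := cramer2 (a - w) w v.
by rewrite dv0 [cross v w]crossC wv0 oppr0 !scale0r addr0 => /eqP; rewrite scaler_eq0 (negPf dw).
Qed.

(** Leaving out [v = 0], where all matrices agree, makes this vanish when [x - y] is invertible. *)
Definition agree x y : int := \sum_(v : 'cV_2 | v != 0) (val x *m v == val y *m v)%:R.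

Lemma agree_sym x y : agree x y = agree y x.
Proof. by apply: eq_bigr => v _; rewrite eq_sym. Qed.

(* The last term, the only one not proportional to [agree], is unchanged when
   [y] is replaced by [- y]. *)
Lemma sum_SL2_interpolants x y w : w != 0 ->
  \sum_(v : 'cV_2 | v != 0) \sum_(z : SL2 F)
     (val x *m v == val z *m v)%:R * (val z *m w == val y *m w)%:R
  = 2 * q * (q - 1) * (val x *m w == val y *m w)%:R
    + (q - 1) * (cross (val y *m w) (val x *m w) != 0)%:R.
Proof.
move=> w_neq0; rewrite (bigID (fun v => cross v w == 0)) /=.
have xw_neq0 : val x *m w != 0.
  by rewrite -(mulmx0 _ (val x)) (inj_eq (@SL2_mulmx_inj x)).
(* For [v] collinear with [w], agreeing with [x] at [v] means agreeing at [w]. So [x] and [y] must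
   agree at [w], and then each of the q - 1 such [v] admits q matrices [z]. *)
rewrite (eq_bigr (fun=> q * (val x *m w == val y *m w)%:R * 1)); last first.
  move=> v /andP[v_neq0 /eqP vw0].
  have [t wE] := cross_eq0 v_neq0 vw0.
  have t_neq0 : t != 0 by apply: contraNneq w_neq0 => t0; rewrite wE t0 scale0r.
  have [xyw|xyw] := eqVneq (val x *m w) (val y *m w); last first.
    rewrite mulr0 mul0r big1 // => z _; case: eqP => [xz|_]; last by rewrite mul0r.
    case: eqP => [zy|_]; last by rewrite mulr0.
    by case/eqP: xyw; rewrite -zy wE -!scalemxAr xz.
  rewrite !mulr1 -(card_SL2_transport w_neq0 xw_neq0) natr_card.
  apply: eq_bigr => z _; rewrite -xyw.
  have -> : (val x *m v == val z *m v) = (val z *m w == val x *m w).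
    by rewrite wE -!scalemxAr (inj_eq (scalerI t_neq0)) eq_sym.
  by case: (_ == _); rewrite ?mulr1 ?mulr0.
rewrite -mulr_sumr sum_collinear //.
(* For [v] independent of [w], pulling back by [x] leaves the condition [cross v a = cross v w] for
   the unique candidate [z] to have determinant 1. [sum_cross_congr] then supplies the second q(q -
   1). *)
have [a xaE] : exists a, val x *m a = val y *m w.
  by exists (invmx (val x) *m (val y *m w)); rewrite mulKVmx ?SL2_unit.
rewrite -xaE (inj_eq (@SL2_mulmx_inj x)) cross_SL2.
rewrite (eq_bigl (fun v => cross v w != 0)) => [|v]; last first.
  by case: eqP => //= ->; rewrite crossC crossv0 oppr0 eqxx.
rewrite (eq_bigr (fun v => (cross v a == cross v w)%:R)) => [|v vw]; last first.
  rewrite -(cross_SL2 x v a) -(card_SL2_frame _ _ vw) natr_card.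
  by apply: eq_bigr => z _; rewrite eq_sym; do 2 case: (_ == _).
rewrite sum_cross_congr // (eq_sym w a); ring.
Qed.

(** Opening both factors and summing over [w] last leaves the counts of [sum_SL2_interpolants]. *)
Lemma agree_sqr x y :
  \sum_z agree x z * agree z y = 2 * q * (q - 1) * agree x y
    + (q - 1) * \sum_(w : 'cV_2 | w != 0) (cross (val y *m w) (val x *m w) != 0)%:R.
Proof.
rewrite /agree !mulr_sumr -big_split /=.
under [RHS]eq_bigr => w w_neq0 do rewrite -sum_SL2_interpolants //.
rewrite [RHS]exchange_big /=.
under [RHS]eq_bigr => v _ do rewrite exchange_big /=.
rewrite [RHS]exchange_big /=; apply: eq_bigr => z _.
rewrite mulr_suml; apply: eq_bigr => v _.
by rewrite mulr_sumr.
Qed.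

(** * Bounds on the quadratic form and on independent sets *)

Lemma agree_form_ge (f : SL2 F -> int) :
  (\sum_x f x) ^+ 2 <= \sum_x \sum_y f x * f y * agree x y.
Proof.
pose nz := [pred v : 'cV[F]_2 | v != 0].
pose Q v := \sum_(w | nz w) (\sum_(x | val x *m v == w) f x) ^+ 2.
have -> : \sum_x \sum_y f x * f y * agree x y = \sum_(v | nz v) Q v.
  transitivity (\sum_x \sum_(v | nz v) f x * \sum_(y | val y *m v == val x *m v) f y).
    apply: eq_bigr => x _; under [RHS]eq_bigr => v _ do rewrite big_mkcond mulr_sumr.
    rewrite exchange_big /=; apply: eq_bigr => y _; rewrite mulr_sumr.
    apply: eq_bigr => v _; rewrite (eq_sym (val y *m v)).
    by case: (_ == _); rewrite ?mulr1 ?mulr0.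
  rewrite exchange_big /=; apply: eq_bigr => v v_neq0.
  rewrite (partition_big (fun x : SL2 F => val x *m v) nz) /= => [|x _]; last first.
    by rewrite -(mulmx0 _ (val x)) (inj_eq (@SL2_mulmx_inj x)).
  apply: eq_bigr => w _; rewrite expr2 mulr_suml.
  by apply: eq_bigr => x /eqP <- /=.
have nz_gt0 : 0 < #|nz|%:R :> int.
  rewrite ltr0n card_cV2_neq0 -subn1 subn_gt0.
  by rewrite (ltn_exp2r 1 _ (isT : 0 < 2)%N) card_finNzRing_gt1.
(* [#|nz|] is both the number of vectors [v] and the number of fibres in each Cauchy-Schwarz
   inequality, so it cancels. *)
rewrite -(ler_pM2l nz_gt0) mulr_sumr mulr_natl -sumr_const.
apply: ler_sum => v v_neq0.
have -> : \sum_x f x = \sum_(w | nz w) \sum_(x | val x *m v == w) f x.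
  apply: partition_big => x _.
  by rewrite /= -(mulmx0 _ (val x)) (inj_eq (@SL2_mulmx_inj x)).
exact: cauchy_schwarz_const.
Qed.

Lemma SL2_opp_subproof x : \det (- val x) == 1.
Proof. by rewrite -scaleN1r detZ sqrrN expr1n mul1r (valP x). Qed.

Definition SL2_opp x : SL2 F := Sub (- val x) (SL2_opp_subproof x).

Lemma SL2_oppK : involutive SL2_opp.
Proof. by move=> x; apply/val_inj/opprK. Qed.

Lemma agree_form_odd_le (g : SL2 F -> int) : (forall x, g (SL2_opp x) = - g x) ->
  \sum_x \sum_y g x * g y * agree x y <= 2 * q * (q - 1) * \sum_x g x ^+ 2.
Proof.
move=> g_odd; apply: quadratic_form_le => [||x].
- have : (1 < #|F|)%N by exact: card_finNzRing_gt1.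
  by rewrite -(ltr_nat int) => q_gt1; rewrite !mulr_gt0 ?subr_gt0 //; lia.
- exact: agree_sym.
pose r y : int := \sum_(w : 'cV_2 | w != 0) (cross (val y *m w) (val x *m w) != 0)%:R.
have r_opp y : r (SL2_opp y) = r y.
  by apply: eq_bigr => w _; rewrite mulNmx crossC crossNr opprK crossC oppr_eq0.
under eq_bigr => y _ do rewrite agree_sqr -/(r y) mulrDl -mulrA -[X in _ + X]mulrA.
rewrite big_split /= -!mulr_sumr; set S := \sum_x r x * g x.
suff -> : S = 0 by rewrite mulr0 addr0.
(* [r] is even and [g] is odd under negation. *)
suff : S = - S by lia.
rewrite {1}/S (reindex_inj (inv_inj SL2_oppK)) -sumrN; apply: eq_bigr => y _.
by rewrite r_opp g_odd mulrN.
Qed.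

Lemma agree_eq0 x y : \det (val x - val y) != 0 -> agree x y = 0.
Proof.
move=> xy_det; apply: big1 => v v_neq0; case: eqP => // xyv; case/eqP: v_neq0.
have xy_unit : val x - val y \in unitmx by rewrite unitmxE unitfE.
by rewrite -(mulKmx xy_unit v) mulmxBl xyv subrr mulmx0.
Qed.

Lemma card_indep_le (A : {set SL2 F}) :
  {in A &, forall x y, \det (val x + val y) != 0} -> (#|A| <= #|F| * #|F|.-1)%N.
Proof.
move=> A_indep.
pose a x : int := (x \in A)%:R; pose b x := a (SL2_opp x).
have sum_a : \sum_x a x = #|A|%:R.
  by rewrite -natr_card; congr (_%:R); apply: eq_card => x; rewrite inE.
have sum_b : \sum_x b x = #|A|%:R.
  by rewrite -sum_a [RHS](reindex_inj (inv_inj SL2_oppK)).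
(* If [x] and [-y] lie in [A], independence makes [x - y] invertible. *)
have ab0 x y : a x * b y * agree x y = 0.
  rewrite /b /a; case: (boolP (x \in A)) => xA; last by rewrite !mul0r.
  case: (boolP (SL2_opp y \in A)) => yA; last by rewrite mulr0 mul0r.
  by rewrite agree_eq0 ?mulr0 //; exact: (A_indep _ _ xA yA).
pose f x := a x + b x; pose g x := a x - b x.
have lb := agree_form_ge f.
have g_odd x : g (SL2_opp x) = - g x by rewrite /g /b SL2_oppK opprB.
have ub := agree_form_odd_le g_odd.
(* The two forms differ only by the mixed terms in [a] and [b], which vanish by [ab0]. *)
have fg : \sum_x \sum_y f x * f y * agree x y = \sum_x \sum_y g x * g y * agree x y.
  apply: eq_bigr => x _; apply: eq_bigr => y _; apply/eqP; rewrite -subr_eq0.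
  have -> : f x * f y * agree x y - g x * g y * agree x y
    = 2 * (a x * b y * agree x y) + 2 * (a y * b x * agree y x).
    by rewrite (agree_sym y x) /f /g; ring.
  by rewrite !ab0.
(* For [a], [b] in {0, 1}, (a - b)^2 <= a + b. *)
have sum_g : \sum_x g x ^+ 2 <= 2 * #|A|%:R.
  rewrite [X in _ <= X](_ : _ = \sum_x f x); last by rewrite big_split /= sum_a sum_b; ring.
  by apply: ler_sum => x _; rewrite /g /f /b /a; do 2 case: (_ \in _).
rewrite -fg in ub; have {lb ub} := le_trans lb ub.
rewrite big_split /= sum_a sum_b.
have q_gt1 : (1 < #|F|)%N by exact: card_finNzRing_gt1.
move=> le1; have [->//|A_gt0] := posnP #|A|.
have le2 : (#|A|%:R + #|A|%:R) ^+ 2 <= 2 * q * (q - 1) * (2 * #|A|%:R).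
  by apply: (le_trans le1); rewrite ler_wpM2l // !mulr_ge0 ?ler0n ?subr_ge0 ?ler1n ?(ltnW q_gt1).
have qE : q - 1 = #|F|.-1%:R by rewrite -{1}(ltn_predK q_gt1) -natr1 addrK.
(* [le2] rearranged so that the positive factor 4|A| can be cancelled. *)
have : 4 * #|A|%:R * (#|A|%:R : int) <= 4 * #|A|%:R * (#|F| * #|F|.-1)%:R.
  by rewrite natrM -qE; move: le2; congr (_ <= _); ring.
by rewrite ler_pM2l ?ler_nat // mulr_gt0 ?ltr0n.
Qed.

End Field.

(** * Bounds on chromatic numbers, and the colouring by first columns *)

Lemma chromatic_number_le_card (G : sgraph) (T : finType) (c : G -> T) :
  (forall x y, edge x y -> c x != c y) -> (chromatic_number G <= #|T|)%N.
Proof.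
move=> c_proper; rewrite /chromatic_number; case: ex_minnP => k _; apply.
apply/existsP; exists [ffun x => enum_rank (c x)].
apply/'forall_forallP => x y; apply/implyP => /c_proper.
by rewrite !ffunE (inj_eq enum_rank_inj).
Qed.

(** The colour classes of an optimal colouring are independent and cover [G]. *)
Lemma card_le_chromatic_number (G : sgraph) (m : nat) :
  (forall A : {set G}, {in A &, forall x y, ~~ edge x y} -> (#|A| <= m)%N) ->
  (#|G| <= chromatic_number G * m)%N.
Proof.
move=> indep_le; rewrite /chromatic_number.
case: ex_minnP => k /existsP[c /'forall_forallP c_proper] _.
rewrite -cardsT -sum1_card (partition_big c predT) //=.
rewrite -[k in leqRHS]card_ord -sum_nat_const; apply: leq_sum => i _.
rewrite (eq_bigl (mem [set x | c x == i])) => [|x]; last by rewrite !inE.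
rewrite sum1_card; apply: indep_le => x y; rewrite !inE => /eqP cx /eqP cy.
by apply: contraL (implyP (c_proper x y)) _ => //; rewrite cx cy eqxx.
Qed.

(* Selects one element of each pair {u, -u}, u != 0. *)
Definition half (F : finFieldType) (u : F) : bool := (enum_rank u < enum_rank (- u))%N.

Lemma half_opp (F : finFieldType) (u : F) : (2 : F) != 0 -> u != 0 ->
  half (- u) = ~~ half u.
Proof.
move=> F2 u_neq0; rewrite /half opprK -leqNgt [RHS]leq_eqVlt [_ == _](_ : _ = false) //.
rewrite (inj_eq (@ord_inj _)) (inj_eq enum_rank_inj) eq_sym -addr_eq0 -mulr2n -mulr_natl.
by rewrite mulf_eq0 (negPf F2) (negPf u_neq0).
Qed.

(** The hypothesis is a square because that is what the determinant identities in
    [column_color_proper] produce; it forces [v = - u]. *)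
Lemma half_neq (F : finFieldType) (u v : F) : (2 : F) != 0 -> u != 0 ->
  (u + v) ^+ 2 = 0 -> half u != half v.
Proof.
move=> F2 u_neq0 /eqP; rewrite sqrf_eq0 addrC addr_eq0 => /eqP ->.
by rewrite half_opp //; case: half.
Qed.

(* The projective point spanned by the first column, together with a choice of
   one vector out of each pair {w, -w} on the corresponding line. *)
Definition column_color (F : finFieldType) (x : SL2 F) : option F * bool :=
  if val x 1 0 == 0 then (None, half (val x 0 0))
  else (Some (val x 0 0 / val x 1 0), half (val x 1 0)).

Lemma column_color_proper (F : finFieldType) (x y : SL2 F) : (2 : F) != 0 ->
  \det (val x + val y) = 0 -> column_color x != column_color y.
Proof.
move=> F2; have /eqP := valP y; have /eqP := valP x.
rewrite /column_color; move: (val x) (val y) => {x y} x y /=.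
rewrite !det_mx22 !mxE.
set a := x 0 0; set b := x 0 1; set c := x 1 0; set d := x 1 1.
set a' := y 0 0; set b' := y 0 1; set c' := y 1 0; set d' := y 1 1.
move=> detx dety det0.
have [c0|c_neq0] := eqVneq c 0; have [c'0|c'_neq0] := eqVneq c' 0 => //.
  rewrite xpair_eqE eqxx /=; apply: half_neq => //.
    apply/eqP => a0; move/eqP: detx.
    by rewrite a0 c0 mul0r mulr0 subr0 eq_sym oner_eq0.
  rewrite c0 c'0 in detx dety det0.
  (* Since ad = a'd' = 1, multiplying det(x + y) by aa' gives (a + a')^2. *)
  have : (a + a') ^+ 2 = (a + a') * (a' * (a * d - b * 0) + a * (a' * d' - b' * 0)).
    by rewrite detx dety; ring.
  move=> ->; transitivity (a * a' * ((a + a') * (d + d') - (b + b') * (0 + 0))); first by ring.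
  by rewrite det0 mulr0.
rewrite xpair_eqE negb_and -implybE; apply/implyP => /eqP[ac].
apply: half_neq => //.
have aE : a = a / c * c by rewrite divfK.
have a'E : a' = a / c * c' by rewrite ac divfK.
move: (a / c) aE a'E => t aE a'E; rewrite aE a'E in detx dety det0.
(* With first columns (tc, c) and (tc', c'), both determinants being 1, cc' det(x + y) equals (c +
   c')^2. *)
have -> : (c + c') ^+ 2 = (c + c') * (c' * (t * c * d - b * c) + c * (t * c' * d' - b' * c')).
  by rewrite detx dety; ring.
transitivity (c * c' * ((t * c + t * c') * (d + d') - (b + b') * (c + c'))); first by ring.
by rewrite det0 mulr0.
Qed.

Lemma pchar_2_neq0 (R : nzRingType) (p : nat) :
  p \in [pchar R] -> (2 < p)%N -> (2 : R) != 0.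
Proof.
move=> charRp p_gt2; rewrite -(dvdn_pcharf charRp); apply/negP => /(@dvdn_leq p 2 isT).
by rewrite leqNgt p_gt2.
Qed.

Local Close Scope ring_scope.

Theorem theorem1p8 (F : finFieldType) (p q : nat) :
  #|F| = q -> p \in [pchar F]%R -> 3 <= p ->
  q + 1 <= chromatic_number (G2 F) <= 8 * (q + 1).
Proof.
move=> qE charFp p_gt2; have q_gt1 : 1 < q by rewrite -qE card_finNzRing_gt1.
apply/andP; split; last first.
  (* The palette has 2(q + 1) colours. *)
  apply: (@leq_trans #|{: option F * bool}|).
    apply: (@chromatic_number_le_card (G2 F) _ (@column_color F)) => x y.
    rewrite (G2_edgeE _ _ charFp p_gt2) => /eqP.
    exact: column_color_proper (pchar_2_neq0 charFp p_gt2).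
  by rewrite card_prod card_option card_bool qE; lia.
have : #|G2 F| <= chromatic_number (G2 F) * (q * q.-1).
  apply: card_le_chromatic_number => A A_indep; rewrite -qE.
  apply: card_indep_le => x y xA yA.
  by rewrite -(G2_edgeE _ _ charFp p_gt2) A_indep.
rewrite card_SL2 qE -subn1 (subn_sqr q 1) -subn1 => le_mul.
(* |SL_2| = (q + 1) q(q - 1), so the bound on independent sets cancels and leaves q + 1. *)
rewrite -(@leq_pmul2r (q * (q - 1))) ?muln_gt0 ?subn_gt0 ?q_gt1 ?(ltnW q_gt1) //.
by apply: leq_trans le_mul; rewrite mulnA mulnC mulnA.
Qed.
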